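(* (Completeness of the rule $\mathbf{Part^P_k}$ for a suitable $P$ and $k$.) Let $(M^{(1)},R^{(1)}),\dots,(M^{(n)},R^{(n)})$ be agents with pairwise asynchronous modules and let $C\subseteq\{1,\dots,n\}$ be a coalition. There exist a partition $P$ of $C$ and $k\le n$ such that the following holds for every $x\in\{\mathrm{ir},\mathrm{iR}\}$ and every family $(\psi_j)_{j\in C}$ of formulas of LTL without the next operator with $\psi_j$ local to agent $j$. If $$(M^{(1)}|\dots|M^{(n)},\,R^{(1)},\dots,R^{(n)})\models_x \langle\langle C\rangle\rangle\bigwedge_{j\in C}\psi_j,$$ then there exist assumptions $A_i$, one for each $P_i\in P$, such that for every $P_i=\{i_1,\dots,i_s\}\in P$, with $M^{(P_i)}=M^{(i_1)}|\dots|M^{(i_s)}$: (1) $(M^{(P_i)}|A_i,\,R^{(i_1)},\dots,R^{(i_s)})\models_x \langle\langle P_i\rangle\rangle\bigwedge_{j\in P_i}\psi_j$, and (2) $\mathit{Comp}^{P_i}_k\models A_i$ (that is, $\mathit{Comp}^{P_i}_k$ guarantees $A_i$).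
   Context: **Modules.** $D$ is a fixed set of values; $D^X$ is the set of valuations $X\to D$. A module is $M=(X,I,Q,T,\lambda,q_0)$ with $X$ (state variables) and $I$ (input variables) finite disjoint sets, $Q$ a finite set of states, $q_0\in Q$ initial, $\lambda:Q\to D^X$, and $T\subseteq Q\times D^I\times Q$ such that (a) for each $(q,\alpha)\in Q\times D^I$ there is $q'$ with $(q,\alpha,q')\in T$, and (b) $(q,\alpha,q')\in T$ and $q\ne q'$ imply $(q,\alpha,q)\notin T$. Modules are asynchronous if their sets of state variables are disjoint. A repertoire for $M$ is a map $R:Q\to\mathcal P(\mathcal P(T))$ such that each $R(q)$ is nonempty and consists of nonempty sets of transitions starting in $q$. An agent is a pair (module, repertoire). **Composition.** Valuations $\rho_1\in D^Y,\rho_2\in D^Z$ are compatible, $\rho_1\sim\rho_2$, if they agree on $Y\cap Z$; then $\rho_1\cup\rho_2\in D^{Y\cup Z}$ is their union. For asynchronous $M^{(1)},M^{(2)}$, the composition $M^{(1)}|M^{(2)}$ has state variables $X=X^{(1)}\uplus X^{(2)}$, inputs $I=(I^{(1)}\cup I^{(2)})\setminus X$, states $Q^{(1)}\times Q^{(2)}$, initial state $(q_0^{(1)},q_0^{(2)})$, labelling $\lambda(q^{(1)},q^{(2)})=\lambda^{(1)}(q^{(1)})\cup\lambda^{(2)}(q^{(2)})$, and transitions as follows. Whenever $(q^{(1)},\alpha^{(1)},q'^{(1)})\in T^{(1)}$, $(q^{(2)},\alpha^{(2)},q'^{(2)})\in T^{(2)}$, $\alpha^{(1)}\sim\alpha^{(2)}$,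 $\lambda^{(1)}(q^{(1)})\sim\alpha^{(2)}$ and $\lambda^{(2)}(q^{(2)})\sim\alpha^{(1)}$, there are transitions from $(q^{(1)},q^{(2)})$, labelled by $\alpha^{(1)}\cup\alpha^{(2)}$ restricted to $I$, to each of $(q'^{(1)},q^{(2)})$, $(q^{(1)},q'^{(2)})$, $(q'^{(1)},q'^{(2)})$; finally every self-loop $(q,\alpha,q)$ for which some $(q,\alpha,q')$ with $q'\neq q$ is present is removed. This extends to any finite number of pairwise asynchronous modules (order is irrelevant); the empty composition is the one-state module with no variables. **Traces.** A trace of $M$ is an infinite sequence $\sigma=q_0\alpha_0q_1\alpha_1\dots$ starting in the initial state with $(q_j,\alpha_j,q_{j+1})\in T$ for all $j$. The word derived with $\sigma$ is $\lambda(q_0)\lambda(q_1)\dots$; the word admitted with $\sigma$ is $\alpha_0\alpha_1\dots$. **Assumptions.** An assumption $A=(M,F)$ is a module with a set $F\subseteq Q$ of accepting states. A word $w=v_0v_1\dots\in(D^X)^\omega$ is accepted by $A$ with computation $\alpha_0\alpha_1\dots$ if there is a trace $\sigma=q_0\alpha_0q_1\alpha_1\dots$ of $M$ with $\lambda(q_j)=v_j$ for all $j$ that visits $F$ infinitely often; $w$ is accepted by $A$ if this holds for some computation. For a module $M$ and an assumption $A'=(M',F')$ with $M,M'$ asynchronous, $M|A'=(M|M',F)$ with $F=\{(q,q')\mid q'\in F'\}$. **Guarantee.** Let $M=M^{(a_1)}|\dots|M^{(a_m)}$ with state variables $X$, and let $A$ be an assumption with state variables $X_A\subseteq X$ and inputs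 $I_A\subseteq\bigcup_l I^{(a_l)}$. Then $M\models A$ (''$M$ guarantees $A$'') if for every trace $\sigma$ of $M$, with derived word $w=w_0w_1\dots$ and admitted word $u=u_0u_1\dots$, there are indices $0=c_0<c_1<c_2<\dots$ and a word $v=v_0v_1\dots\in (D^{X_A})^\omega$ with $v_i=w_l|_{X_A}$ for all $i$ and all $c_i\le l<c_{i+1}$ (a curtailment of $w$ to $X_A$) such that $v$ is accepted by $A$ with the computation $a_0a_1\dots$, where $a_i\in D^{I_A}$ is the restriction to $I_A$ of $u_{c_{i+1}-1}\cup w_{c_{i+1}-1}$ (variables of $I_A$ that are state variables of $M$ take their value from $w$, the others from $u$). The relation $M\models A$ is only asserted when $X_A\subseteq X$ and $I_A\subseteq\bigcup_l I^{(a_l)}$ hold. **Strategies.** In a system whose global states are tuples of local states of component modules, an ir-strategy (memoryless) of agent $i$ is $s_i:Q^{(i)}\to\mathcal P(T^{(i)})$ with $s_i(q)\in R^{(i)}(q)$. An iR-strategy (perfect recall) is $s_i:(Q^{(i)})^+\to\mathcal P(T^{(i)})$ with $s_i(q_1,\dots,q_m)\in R^{(i)}(q_m)$ which is stuttering-invariant: its value is unchanged when consecutive repetitions of a state are merged. A trace $\sigma=q_0\alpha_0q_1\alpha_1\dots$ of the composed module implements $s_i$ if for all $j$ with $q_j^{(i)}\ne q_{j+1}^{(i)}$ we have $(q_j^{(i)},\beta_j,q_{j+1}^{(i)})\in s_i(q_j^{(i)})$ (for iR: $\in s_i(q_0^{(i)},\dots,q_j^{(i)})$), where $\beta_j\in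 D^{I^{(i)}}$ takes the value $\lambda(q_j)(y)$ on input variables $y$ that are state variables of the composed module, and $\alpha_j(y)$ otherwise. A joint strategy $s_C$ is a family of strategies $s_i$, $i\in C$; a trace implements $s_C$ if it implements each $s_i$; a word implements $s_C$ if it is derived with some trace implementing $s_C$. **Semantics.** LTL without next: $\gamma::=p\mid\neg\gamma\mid\gamma\wedge\gamma\mid\gamma\,\mathrm U\,\gamma$, where an atom is a valuation $p:Y\to D$, true on a word $w$ iff $w[0]|_Y=p$; $\mathrm U$ is strong until, interpreted on infinite words as usual. For a system $(M,R^{(1)},\dots)$ we write $\models_x\langle\langle C\rangle\rangle\gamma$ if there is a joint $x$-strategy $s_C$ such that every word (from the initial state) implementing $s_C$ satisfies $\gamma$. For a system based on an assumption $A$, $\models_x\langle\langle C\rangle\rangle\gamma$ if there is a joint $x$-strategy $s_C$ such that every word that implements $s_C$ and is accepted by $A$ satisfies $\gamma$; the component coming from the assumption has no strategy. Such statements presuppose that all variables of $\gamma$ are state variables of the composed module. A formula is local to agent $i$ if its atoms are valuations of variables of $M^{(i)}$ (state or input variables). **Neighbourhoods.** $N^{(j)}_1$ is the set of indices $l$ with $I^{(l)}\cap X^{(j)}\neq\varnothing$ or $I^{(j)}\cap X^{(l)}\ne\varnothing$. For a set $P_i$ of agents, $N^{P_i}_1=(\bigcup_{j\in P_i}N^{(j)}_1)\setminus P_i$, and for $k>1$, $N^{P_i}_k=(N^{P_i}_{k-1}\cup\bigcup_{j\in N^{P_i}_{k-1}}N^{(j)}_1)\setminus P_i$ (so $k\ge1$).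 $\mathit{Comp}^{P_i}_k$ is the composition of the modules $M^{(j)}$, $j\in N^{P_i}_k$. *)

(* Defs.v *)
From mathcomp Require Import all_boot finmap.
From mathcomp Require Import classical_sets.

Set Implicit Arguments.
Unset Strict Implicit.
Unset Printing Implicit Defensive.

Section Modules.
Context (V : choiceType) (D : Type).

(* An element of D^Y, for a finite set of variables Y, is a finite map f with
   domf f = Y; f.[& Z] is the restriction of f to Z, and (f + g)%fset the union
   of f and g (g has priority where both are defined). *)
Definition valuation := {fmap V -> D}.

Definition compatible (f g : valuation) : Prop :=
  forall y, y \in domf f -> y \in domf g -> (f.[? y] = g.[? y])%fmap.

Record module := Module {
  stvars : {fset V};
  invars : {fset V};
  vars_disj : [disjoint stvars & invars]%fset;
  state : finType;
  init : state;
  label : state -> valuation;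
  label_dom : forall q, domf (label q) = stvars;
  trans : set (state * valuation * state);
  trans_dom : forall q a q', trans (q, a, q') -> domf a = invars;
  trans_serial : forall q a, domf a = invars -> exists q', trans (q, a, q');
  trans_noloop : forall q a q', trans (q, a, q') -> q <> q' -> ~ trans (q, a, q)
}.

Definition transition (M : module) : Type := (state M * valuation * state M)%type.

Definition asynchronous (M1 M2 : module) : bool :=
  [disjoint stvars M1 & stvars M2]%fset.

Definition pairwise_async (J : Type) (M : J -> module) : Prop :=
  forall i j, i <> j -> asynchronous (M i) (M j).

Record repertoire (M : module) := Repertoire {
  rep :> state M -> set (set (transition M));
  rep_nonempty : forall q, (rep q !=set0)%classic;
  rep_trans : forall q S, rep q S ->
    [/\ (S !=set0)%classic, (S `<=` @trans M)%classic
      & forall t, S t -> t.1.1 = q]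
}.

(* Removes the self-loops (q, a, q) for which another (q, a, q') is present. *)
Definition prune (Q : Type) (S : set (Q * valuation * Q))
    : set (Q * valuation * Q) :=
  fun t => S t /\ (t.1.1 = t.2 -> forall q', S (t.1.1, t.1.2, q') -> q' = t.2).

Lemma prune_serial (Q : Type) (S : set (Q * valuation * Q)) q a q' :
  S (q, a, q') -> exists q'', prune S (q, a, q'').
Proof.
move=> Sq'; have [[p [Sp pq]]|no] :=
  boolp.pselect (exists p, S (q, a, p) /\ p <> q).
  by exists p; split=> // qp; case: pq.
exists q'; split=> //= qq' p Sp; rewrite -qq'.
by have [//|pq] := boolp.pselect (p = q); case: no; exists p.
Qed.

Lemma prune_noloop (Q : Type) (S : set (Q * valuation * Q)) q a q' :
  prune S (q, a, q') -> q <> q' -> ~ prune S (q, a, q).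
Proof. by move=> [Sq' _] qq' [_ /(_ erefl _ Sq')] /esym. Qed.

Lemma in_domf_cat (f g : valuation) y :
  (y \in domf (f + g)%fset) = (y \in domf f) || (y \in domf g).
Proof. by rewrite domf_cat inE. Qed.

Lemma in_domf_restrict (f : valuation) A y :
  (y \in domf f.[& A]%fmap) = (y \in A) && (y \in domf f).
Proof. by rewrite mem_restrictf. Qed.

Lemma in_label (M : module) (q : state M) y :
  (y \in domf (label q)) = (y \in stvars M).
Proof. by rewrite label_dom. Qed.

Lemma compatible_sym f g : compatible f g -> compatible g f.
Proof. by move=> fg y yg yf; rewrite fg. Qed.

Section BinaryComposition.
Context (M1 M2 : module).

Definition comp_stvars := (stvars M1 `|` stvars M2)%fset.
Definition comp_invars := ((invars M1 `|` invars M2) `\` comp_stvars)%fset.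
Definition comp_label (q : state M1 * state M2) : valuation :=
  (label q.1 + label q.2)%fset.

Definition comp_step : set (_ * valuation * (state M1 * state M2)) := fun t =>
  exists (a1 a2 : valuation) (r1 : state M1) (r2 : state M2),
    [/\ trans (t.1.1.1, a1, r1) /\ trans (t.1.1.2, a2, r2),
        [/\ compatible a1 a2,
            compatible (label t.1.1.1) a2
          & compatible (label t.1.1.2) a1],
        t.1.2 = ((a1 + a2)%fset.[& comp_invars])%fmap
      & [\/ t.2 = (r1, t.1.1.2), t.2 = (t.1.1.1, r2) | t.2 = (r1, r2)]].

Lemma comp_disj : [disjoint comp_stvars & comp_invars]%fset.
Proof.
by rewrite fdisjoint_sym; apply/fdisjointP => y; rewrite inE => /andP[].
Qed.

Lemma comp_label_dom q : domf (comp_label q) = comp_stvars.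
Proof. by apply/fsetP => y; rewrite in_domf_cat !inE /= !label_dom. Qed.

Lemma comp_trans_dom q a q' : prune comp_step (q, a, q') -> domf a = comp_invars.
Proof.
move=> [[a1 [a2 [r1 [r2 [[/trans_dom d1 /trans_dom d2] _ /= -> _]]]]] _].
apply/fsetP => y; rewrite in_domf_restrict in_domf_cat.
by rewrite d1 d2 !inE; do !case: (y \in _).
Qed.

Lemma comp_trans_serial q a :
  domf a = comp_invars -> exists q', prune comp_step (q, a, q').
Proof.
case: q => q1 q2 da.
pose w := (label q1 + (label q2 + a))%fset.
have dw y : (y \in domf w) =
    [|| y \in stvars M1, y \in stvars M2 | y \in domf a].
  by rewrite -(label_dom q1) -(label_dom q2) !in_domf_cat.
have dom1 : domf (w.[& invars M1])%fmap = invars M1.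
  apply/fsetP => y; rewrite in_domf_restrict dw da !inE.
  by do !case: (y \in _).
have dom2 : domf (w.[& invars M2])%fmap = invars M2.
  apply/fsetP => y; rewrite in_domf_restrict dw da !inE.
  by do !case: (y \in _).
have [r1 t1] := trans_serial q1 dom1; have [r2 t2] := trans_serial q2 dom2.
apply: (@prune_serial _ _ _ _ (r1, r2)).
exists (w.[& invars M1])%fmap, (w.[& invars M2])%fmap, r1, r2.
split=> //=; last by apply: Or33.
  split=> y; rewrite ?label_dom !in_domf_restrict ?fnd_restrict.
  - by move=> /andP[-> _] /andP[-> _].
  - move=> y1 /andP[y2 _]; rewrite label_dom in y1.
    have y2' : y \notin stvars M2.
      by apply/negP => ys; move/fdisjointP: (vars_disj M2) => /(_ y ys)/negP.
    have ya : y \notin domf a by rewrite da !inE y1.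
    by rewrite y2 !fnd_cat in_domf_cat (negPf ya) in_label (negPf y2').
  - move=> y2 /andP[y1 _]; rewrite label_dom in y2.
    have ya : y \notin domf a by rewrite da !inE y2 orbT.
    by rewrite y1 !fnd_cat in_domf_cat (negPf ya) in_label y2.
apply/fmapP => y; rewrite fnd_restrict fnd_cat in_domf_restrict dw -da.
case: ifP => ya; last by rewrite not_fnd ?ya.
have : y \in comp_invars by rewrite -da.
rewrite !inE => /andP[_ yI].
rewrite ya !orbT andbT !fnd_restrict.
have -> : (w.[? y] = a.[? y])%fmap by rewrite !fnd_cat in_domf_cat ya orbT.
by case: ifP => // y2; rewrite ifT //; move: yI; rewrite y2 orbF.
Qed.

Definition comp : module :=
  {| vars_disj := comp_disj; init := (init M1, init M2);
     label_dom := comp_label_dom; trans_dom := comp_trans_dom;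
     trans_serial := comp_trans_serial;
     trans_noloop := @prune_noloop _ comp_step |}.

End BinaryComposition.

Section FamilyUnion.
Context (J : finType) (f : J -> valuation).

Definition bigcat : valuation := \big[@catf V D/[fmap]%fmap]_(j : J) f j.

Lemma mem_bigcat y : (y \in domf bigcat) = [exists j, y \in domf (f j)].
Proof.
rewrite /bigcat; apply/idP/existsP => [|[j yj]].
  elim/big_ind: _ => [|g h IHg IHh|j _ yj]; last by exists j.
    by rewrite inE.
  by rewrite in_domf_cat => /orP[/IHg|/IHh].
have := mem_index_enum j; elim: (index_enum J) => // i s IHs.
rewrite inE big_cons in_domf_cat => /orP[/eqP <-|/IHs]; first by rewrite yj.
by move=> ->; rewrite orbT.
Qed.

Lemma fnd_bigcat j y : (forall i k, compatible (f i) (f k)) ->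
  y \in domf (f j) -> (bigcat.[? y] = (f j).[? y])%fmap.
Proof.
move=> cf yj; have : y \in domf bigcat.
  by rewrite mem_bigcat; apply/existsP; exists j.
rewrite /bigcat; elim/big_ind: _ => [|g h IHg IHh|i _ yi]; last exact: cf.
  by rewrite inE.
rewrite in_domf_cat fnd_cat; case: ifP => [/IHh //|_].
by rewrite orbF => /IHg.
Qed.

End FamilyUnion.

(* The composition of a finite family of pairwise asynchronous modules, as a
   single product.  A step is built from one transition of every component,
   and an arbitrary set of components takes its transition while the others
   keep their state.  That this set may be empty only matters for the empty
   family: the step that keeps every state is otherwise pruned, or it is
   also obtained from a nonempty set of components.  By agree_stvars,
   agree_invars, agree_label and bigcomp_None below, composing a family over
   option J is the same as composing its restriction to J with the remaining
   module by comp. *)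
Section FamilyComposition.
Context (J : finType) (M : J -> module) (asyncM : pairwise_async M).

Definition bigcomp_stvars := (\bigcup_(j <- enum J) stvars (M j))%fset.
Definition bigcomp_invars :=
  ((\bigcup_(j <- enum J) invars (M j)) `\` bigcomp_stvars)%fset.
Definition bigcomp_state : finType := {dffun forall j : J, state (M j)}.
Definition bigcomp_init : bigcomp_state := [ffun j : J => init (M j)].
Definition bigcomp_label (q : bigcomp_state) : valuation :=
  bigcat (fun j => label (q j)).

Definition bigcomp_step : set (bigcomp_state * valuation * bigcomp_state) :=
  fun t => exists (a : J -> valuation) (r : forall j, state (M j)),
    [/\ forall j, trans (t.1.1 j, a j, r j),
        (forall i j, compatible (a i) (a j))
          /\ (forall i j, i <> j -> compatible (label (t.1.1 i)) (a j)),
        t.1.2 = (bigcat a).[& bigcomp_invars]%fmap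
      & forall j, t.2 j = t.1.1 j \/ t.2 j = r j].

Lemma bigcomp_disj : [disjoint bigcomp_stvars & bigcomp_invars]%fset.
Proof.
by rewrite fdisjoint_sym; apply/fdisjointP => y; rewrite inE => /andP[].
Qed.

Lemma mem_bigcup (F : J -> {fset V}) y :
  (y \in (\bigcup_(j <- enum J) F j)%fset) = [exists j, y \in F j].
Proof.
apply/bigfcupP/existsP => [[j _ yj]|[j yj]]; first by exists j.
by exists j => //; rewrite mem_enum.
Qed.

Lemma bigcomp_label_dom q : domf (bigcomp_label q) = bigcomp_stvars.
Proof.
apply/fsetP => y; rewrite mem_bigcat mem_bigcup.
by apply: eq_existsb => j; rewrite label_dom.
Qed.

Lemma bigcomp_trans_dom q a q' :
  prune bigcomp_step (q, a, q') -> domf a = bigcomp_invars.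
Proof.
move=> [[b [r [/= tb _ -> _]]] _]; apply/fsetP => y; rewrite in_domf_restrict.
rewrite mem_bigcat.
rewrite [LHS]andbC; apply: andb_idl; rewrite inE mem_bigcup => /andP[_].
by move=> /existsP[j yj]; apply/existsP; exists j; rewrite (trans_dom (tb j)).
Qed.

Lemma compatible_label (q : bigcomp_state) i j :
  compatible (label (q i)) (label (q j)).
Proof.
have [<-//|/eqP ij] := eqVneq i j.
move=> y; rewrite !in_label => yi yj.
by have /fdisjointP/(_ y yi)/negP := asyncM ij.
Qed.

Lemma in_bigcomp_label q y :
  (y \in domf (bigcomp_label q)) = (y \in bigcomp_stvars).
Proof. by rewrite bigcomp_label_dom. Qed.

Lemma bigcomp_trans_serial q a :
  domf a = bigcomp_invars -> exists q', prune bigcomp_step (q, a, q').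
Proof.
move=> da; pose w := (a + bigcomp_label q)%fset.
have dw y : (y \in domf w) = (y \in bigcomp_invars) || (y \in bigcomp_stvars).
  by rewrite in_domf_cat da in_bigcomp_label.
have domI j : domf (w.[& invars (M j)])%fmap = invars (M j).
  apply/fsetP => y; rewrite in_domf_restrict dw; apply: andb_idr => yj.
  rewrite in_fsetD mem_bigcup; case: (y \in _) => //=; rewrite orbF.
  by apply/existsP; exists j.
have inI j y : (y \in domf (w.[& invars (M j)])%fmap) = (y \in invars (M j)).
  by rewrite domI.
have wC i k : compatible (w.[& invars (M i)])%fmap (w.[& invars (M k)])%fmap.
  by move=> y; rewrite !inI !fnd_restrict => -> ->.
have [r tr] := fin_all_exists (fun j => trans_serial (q j) (domI j)).
apply: (@prune_serial _ _ _ _ ([ffun j : J => r j] : bigcomp_state)).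
exists (fun j => w.[& invars (M j)])%fmap, r; split=> //=; last first.
- by move=> j; right; rewrite ffunE.
- apply/fmapP => y; rewrite fnd_restrict.
  case: ifP => yI; last first.
    by apply: not_fnd; change (y \notin domf a); rewrite da yI.
  have := yI; rewrite in_fsetD mem_bigcup => /andP[yX /existsP[j yj]].
  rewrite (@fnd_bigcat _ _ j) ?inI // fnd_restrict yj fnd_cat.
  by rewrite in_bigcomp_label (negPf yX).
split=> // i j _ y; rewrite inI in_label => yi yj.
rewrite fnd_restrict yj fnd_cat in_bigcomp_label mem_bigcup.
rewrite ifT; last by apply/existsP; exists i.
by rewrite (@fnd_bigcat _ _ i) ?in_label // => k l; apply: compatible_label.
Qed.

Definition bigcomp : module :=
  {| vars_disj := bigcomp_disj; init := bigcomp_init;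
     label_dom := bigcomp_label_dom; trans_dom := bigcomp_trans_dom;
     trans_serial := bigcomp_trans_serial;
     trans_noloop := @prune_noloop _ bigcomp_step |}.

End FamilyComposition.

Section Agreement.
Context (J : finType) (M : option J -> module) (asyncM : pairwise_async M).
Let M1 (j : J) := M (Some j).
Context (asyncM1 : pairwise_async M1).
Let N := comp (bigcomp asyncM1) (M None).

Definition split_state (q : bigcomp_state M) :
    bigcomp_state M1 * state (M None) :=
  ([ffun j : J => q (Some j)] : bigcomp_state M1, q None).

Definition unsplit_state (t : bigcomp_state M1 * state (M None)) :
    bigcomp_state M :=
  [ffun o : option J => match o return state (M o) with
                        | Some j => t.1 j | None => t.2 end].

Lemma split_stateK : cancel split_state unsplit_state.
Proof. by move=> q; apply/ffunP => -[j|]; rewrite !ffunE. Qed.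

Lemma unsplit_stateK : cancel unsplit_state split_state.
Proof.
move=> [t1 t2]; rewrite /split_state ffunE; congr pair.
by apply/ffunP => j; rewrite !ffunE.
Qed.

Lemma exists_option (p : pred (option J)) :
  [exists o, p o] = [exists j, p (Some j)] || p None.
Proof.
apply/existsP/orP => [[[j|] po]|[/existsP[j po]|po]]; [left|by right| |].
- by apply/existsP; exists j.
- by exists (Some j).
- by exists None.
Qed.

Lemma agree_stvars : stvars N = stvars (bigcomp asyncM).
Proof. by apply/fsetP => y; rewrite in_fsetU !mem_bigcup exists_option. Qed.

Lemma agree_invars : invars N = invars (bigcomp asyncM).
Proof.
apply/fsetP => y; rewrite !(in_fsetD, in_fsetU, mem_bigcup) !exists_option.
by do !case: [exists _, _]; do ?case: (_ \in _).
Qed.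

Lemma agree_label q :
  label (split_state q : state N) = label (q : state (bigcomp asyncM)).
Proof.
have cl : forall i k, compatible (label (q i)) (label (q k)).
  by move=> i k; apply: (compatible_label asyncM).
have cl1 : forall i k,
    compatible (label ((split_state q).1 i)) (label ((split_state q).1 k)).
  by move=> i k; rewrite !ffunE; apply: cl.
apply/fmapP => y; rewrite fnd_cat.
case: ifP => [yN|yN]; first by rewrite (fnd_bigcat cl (j := None)).
have [/existsP[j yj]|no] := boolP [exists j, y \in domf (label (q (Some j)))].
  rewrite (fnd_bigcat cl yj) (fnd_bigcat cl1 (j := j)) ?ffunE //.
rewrite !not_fnd //.
  change (y \notin domf (bigcat (fun j => label (q j)))).
  by rewrite mem_bigcat exists_option negb_or no yN.
change (y \notin domf (bigcat (fun j => label ((split_state q).1 j)))).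
rewrite mem_bigcat.
by apply: contraNN no => /existsP[j]; rewrite ffunE => ?; apply/existsP; exists j.
Qed.

Lemma agree_step_of_comp q a t :
  comp_step (M1 := bigcomp asyncM1) (split_state q, a, t) ->
  bigcomp_step (q, a, unsplit_state t).
Proof.
move=> [a1 [a2 [r1 [r2 [[/= t1 t2] [c12 c1 c2] ea et]]]]].
have [[b [r [/= tb [cb lb] ea1 er]]] _] := t1.
pose bb o := if o is Some j then b j else a2.
have db j y : (y \in domf (b j)) = (y \in invars (M (Some j))).
  by rewrite (trans_dom (tb j)).
have d2 y : (y \in domf a2) = (y \in invars (M None)) by rewrite (trans_dom t2).
have cl1 i k :
    compatible (label ((split_state q).1 i)) (label ((split_state q).1 k)).
  exact: (compatible_label asyncM1).
have lbq i j : i <> j -> compatible (label (q (Some i))) (b j).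
  by move=> /lb; rewrite ffunE.
have l2 i : compatible (label (q (Some i))) a2.
  move=> y yi y2; rewrite -c1 //; last first.
    rewrite in_bigcomp_label mem_bigcup; apply/existsP; exists i.
    by rewrite -(in_label (q (Some i))).
  by rewrite (fnd_bigcat cl1 (j := i)) ffunE.
have a1E j y : y \in invars (M (Some j)) -> y \notin bigcomp_stvars M1 ->
    (y \in domf a1) /\ (a1.[? y] = (b j).[? y])%fmap.
  move=> yj yX; have yI : y \in bigcomp_invars M1.
    by rewrite in_fsetD yX mem_bigcup; apply/existsP; exists j.
  rewrite ea1 in_domf_restrict yI fnd_restrict yI (fnd_bigcat cb (j := j)) ?db //.
  by split=> //; rewrite mem_bigcat; apply/existsP; exists j; rewrite db.
have cb2 j : compatible (b j) a2.
  move=> y; rewrite db => yj y2.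
  have [|yX] := boolP (y \in bigcomp_stvars M1); last first.
    by have [y1 <-] := a1E _ _ yj yX; rewrite c12.
  rewrite mem_bigcup => /existsP[i yi].
  have ij : i <> j.
    move=> ij; move/fdisjointP: (vars_disj (M (Some j))) => /(_ y).
    by rewrite -{1}ij => /(_ yi)/negP.
  by rewrite -(lbq _ _ ij) ?in_label ?db // l2 ?in_label.
have cbb i j : compatible (bb i) (bb j).
  case: i j => [i|] [j|] //=; by [apply: cb|apply: cb2|apply/compatible_sym/cb2].
pose rr o : state (M o) := if o is Some j then r j else r2.
exists bb, rr; split=> /=.
- case=> [j|] //=; first by have := tb j; rewrite ffunE.
- split=> // -[i|] [j|] // ij /=.
  + by apply: lbq => ij'; apply: ij; rewrite ij'.
  + move=> y y2 yj; move: (yj); rewrite db => yj'.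
    have yX : y \notin bigcomp_stvars M1.
      rewrite mem_bigcup; apply/negP => /existsP[i yi].
      have /fdisjointP/(_ y yi)/negP : asynchronous (M (Some i)) (M None).
        exact: asyncM.
      by rewrite -(in_label (q None)).
    by have [y1 <-] := a1E _ _ yj' yX; rewrite c2.
- rewrite ea; apply/fmapP => y.
  rewrite !fnd_restrict [comp_invars _ _]agree_invars; case: ifP => // yI.
  have := yI; rewrite in_fsetD => /andP[yX _].
  rewrite fnd_cat; case: ifP => y2; first by rewrite (fnd_bigcat cbb (j := None)).
  have yX1 : y \notin bigcomp_stvars M1.
    apply: contraNN yX => yX.
    by rewrite [bigcomp_stvars _](esym agree_stvars) in_fsetU yX.
  have : [exists j, y \in invars (M (Some j))].
    move: yI; rewrite in_fsetD mem_bigcup exists_option -d2 y2 orbF.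
    by case/andP.
  move=> /existsP[j yj]; have [_ ->] := a1E _ _ yj yX1.
  by rewrite (fnd_bigcat cbb (j := Some j)) //= db.
have [] : (t.1 = (split_state q).1 \/ t.1 = r1) /\ (t.2 = q None \/ t.2 = r2).
  by case: et => ->; split; [right|left|left|right|right|right].
move=> e1 e2 [j|]; rewrite ffunE //.
by case: e1 => ->; [left; rewrite ffunE|have := er j; rewrite ffunE].
Qed.

Lemma agree_comp_of_step q a q' :
  bigcomp_step (q, a, q') -> q <> q' ->
  comp_step (M1 := bigcomp asyncM1) (split_state q, a, split_state q').
Proof.
move=> [b [r [/= tb [cb lb] ea eq']]] qq'.
have db o y : (y \in domf (b o)) = (y \in invars (M o)).
  by rewrite (trans_dom (tb o)).
have cl i k : compatible (label (q i)) (label (q k)).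
  exact: (compatible_label asyncM).
pose q1 := (split_state q).1; pose q1' := (split_state q').1.
pose a1 := ((bigcat (fun j => b (Some j))).[& bigcomp_invars M1])%fmap.
have cb1 i k : compatible (b (Some i)) (b (Some k)) by apply: cb.
have cl1 i k : compatible (label (q1 i)) (label (q1 k)).
  exact: (compatible_label asyncM1).
have da1 y : y \in domf a1 ->
    exists2 j, y \in invars (M (Some j)) & (a1.[? y] = (b (Some j)).[? y])%fmap.
  rewrite in_domf_restrict mem_bigcat => /andP[yI /existsP[j yj]].
  by exists j; [rewrite -db|rewrite fnd_restrict yI (fnd_bigcat cb1 yj)].
have step1 (p : bigcomp_state M1) : (forall j, p j = q1 j \/ p j = r (Some j)) ->
    bigcomp_step (q1, a1, p).
  move=> hp; exists (fun j => b (Some j)), (fun j => r (Some j)); split=> //=.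
  - by move=> j; rewrite ffunE; apply: tb.
  - by split=> // i j ij; rewrite ffunE; apply: lb => -[].
have s1 : bigcomp_step (q1, a1, q1').
  by apply: step1 => j; rewrite !ffunE; apply: eq'.
have [r1 [t1 r1E]] : exists r1, prune (@bigcomp_step _ M1) (q1, a1, r1)
    /\ (q1' <> q1 -> r1 = q1').
  have [e|ne] := eqVneq q1' q1; last first.
    by exists q1'; split=> //; split=> // /= e; rewrite e eqxx in ne.
  by have [r1 t1] := prune_serial s1; exists r1.
exists a1, (b None), r1, (r None); split=> /=.
- by split.
- split.
  + by move=> y /da1[j yj ->] y2; apply: (cb (Some j) None); rewrite // db.
  + move=> y; rewrite mem_bigcat => /existsP[j]; rewrite ffunE => yj y2.
    rewrite (fnd_bigcat cl1 (j := j)) ffunE //.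
    by apply: (lb (Some j) None).
  + move=> y y2 /da1[j yj ->].
    by apply: (lb None (Some j)); rewrite // db.
- rewrite ea [comp_invars _ _]agree_invars; apply/fmapP => y.
  rewrite !fnd_restrict; case: ifP => // yI; rewrite fnd_cat.
  case: ifP => y2; first by rewrite (fnd_bigcat cb (j := None)).
  have := yI; rewrite in_fsetD mem_bigcup exists_option -db y2 orbF.
  case/andP=> yX /existsP[j yj].
  rewrite fnd_restrict ifT ?(fnd_bigcat cb (j := Some j)) ?db //.
    by rewrite (fnd_bigcat cb1 (j := j)) ?db.
  rewrite in_fsetD mem_bigcup; apply/andP; split.
    by apply: contraNN yX; rewrite !mem_bigcup exists_option => ->.
  by apply/existsP; exists j.
rewrite /split_state -/q1 -/q1' -[[ffun j => q' (Some j)]]/q1'.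
have [e|/eqP ne] := eqVneq q1' q1.
  have [e2|->] := eq' None; last by apply: Or32; rewrite e.
  case: qq'; rewrite -[q]split_stateK -[q']split_stateK; congr unsplit_state.
  by rewrite /split_state e2; congr pair.
rewrite (r1E ne); by case: (eq' None) => ->; [apply: Or31|apply: Or33].
Qed.

Lemma bigcomp_None q a q' :
  @trans (bigcomp asyncM) (q, a, q')
    <-> @trans N (split_state q, a, split_state q').
Proof.
split=> [[s h]|[s h]].
  have [e|/eqP ne] := eqVneq q q'; last first.
    split; first exact: agree_comp_of_step.
    by move=> /= /(can_inj split_stateK).
  have da : domf a = invars N.
    by rewrite agree_invars; apply: (@bigcomp_trans_dom _ _ q a q').
  have [t [st ht]] := @trans_serial N (split_state q) a da.
  have Et p : comp_step (M1 := bigcomp asyncM1) (split_state q, a, p) ->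
      p = split_state q.
    move=> /agree_step_of_comp /(h e) /= up.
    by rewrite e -up unsplit_stateK.
  by rewrite -e; split=> [|_ p /Et //]; rewrite -{2}(Et _ st).
split; first by have := agree_step_of_comp s; rewrite split_stateK.
move=> /= e p sp; have [//|/eqP ne] := eqVneq p q'.
have np : q <> p by rewrite e => ep; apply: ne.
have /h := agree_comp_of_step sp np.
by rewrite /= e => /(_ erefl) /(can_inj split_stateK).
Qed.

End Agreement.

Section SubFamily.
Context (J : finType) (M : J -> module) (P : {set J}).

Definition subfamily (j : {j : J | j \in P}) : module := M (val j).

Lemma subfamily_async : pairwise_async M -> pairwise_async subfamily.
Proof. by move=> asyncM i j ij; apply: asyncM => /val_inj. Qed.

End SubFamily.

Section Traces.
Context (M : module).

Definition is_trace (q : nat -> state M) (a : nat -> valuation) : Prop :=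
  q 0 = init M /\ forall j, trans (q j, a j, q j.+1).

Definition derived (q : nat -> state M) : nat -> valuation :=
  fun j => label (q j).

End Traces.

Record assumption := Assumption {
  amod :> module;
  accepting : {set state amod}
}.

Definition accepted_with (A : assumption) (w a : nat -> valuation) : Prop :=
  exists q : nat -> state A,
    [/\ is_trace q a, forall j, label (q j) = w j
      & forall m, exists2 j, m <= j & q j \in accepting A].

Definition accepted (A : assumption) (w : nat -> valuation) : Prop :=
  exists a, accepted_with A w a.

Definition comp_assumption (M : module) (A : assumption) : assumption :=
  {| amod := comp M A;
     accepting := [set q : state M * state A | q.2 \in accepting A]%SET |}.

(* In the following clause (u + w)%fset is the union of the admitted and the
   derived valuation of the composed module, whose domains are disjoint. *)
Definition guarantees (J : finType) (M : J -> module)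
    (asyncM : pairwise_async M) (A : assumption) : Prop :=
  [/\ (stvars A `<=` bigcomp_stvars M)%fset,
      (invars A `<=` \bigcup_(j <- enum J) invars (M j))%fset
    & forall (q : nat -> state (bigcomp asyncM)) (u : nat -> valuation),
      is_trace q u ->
      exists (c : nat -> nat) (v : nat -> valuation),
        [/\ c 0 = 0, forall i, c i < c i.+1,
            forall i l, c i <= l < c i.+1 -> v i = (label (q l)).[& stvars A]%fmap
          & accepted_with A v (fun i =>
              let l := (c i.+1).-1 in
              ((u l + label (q l))%fset.[& invars A])%fmap)]].

Inductive memory := ir | iR.

(* A history is a nonempty sequence of states; the value of a strategy with
   perfect recall at [::] is irrelevant. *)
Definition strategy (x : memory) (M : module) : Type :=
  match x with
  | ir => state M -> set (transition M)
  | iR => seq (state M) -> set (transition M)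
  end.

Definition is_strategy (x : memory) (M : module) (R : repertoire M) :
    strategy x M -> Prop :=
  match x with
  | ir => fun s => forall q, R q (s q)
  | iR => fun s =>
      (forall h q, R q (s (rcons h q)))
      /\ (forall h q h', s (h ++ [:: q, q & h']) = s (h ++ q :: h'))
  end.

Definition prescribed (x : memory) (M : module) :
    strategy x M -> (nat -> state M) -> nat -> set (transition M) :=
  match x with
  | ir => fun s q j => s (q j)
  | iR => fun s q j => s (mkseq q j.+1)
  end.

Inductive ltl :=
| Atom of valuation
| Not of ltl
| And of ltl & ltl
| Until of ltl & ltl.

(* The atom of the empty valuation holds on every word. *)
Definition LTrue : ltl := Atom [fmap]%fmap.

Fixpoint ltl_vars (g : ltl) : {fset V} :=
  match g with
  | Atom p => domf p
  | Not g => ltl_vars g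
  | And g h | Until g h => (ltl_vars g `|` ltl_vars h)%fset
  end.

Fixpoint sat (w : nat -> valuation) (g : ltl) : Prop :=
  match g with
  | Atom p => (w 0).[& domf p]%fmap = p
  | Not g => ~ sat w g
  | And g h => sat w g /\ sat w h
  | Until g h =>
      exists2 j, sat (fun t => w (j + t)) h
               & forall i, i < j -> sat (fun t => w (i + t)) g
  end.

Definition local (M : module) (g : ltl) : Prop :=
  (ltl_vars g `<=` stvars M `|` invars M)%fset.

(* N is a composed module having the agents (M j, R j) among its components;
   comp_state q j is the local state of agent j in the global state q. *)
Section Strategic.
Context (J : finType) (M : J -> module) (R : forall j, repertoire (M j)).
Context (N : module) (comp_state : state N -> forall j, state (M j)).

Definition implements (x : memory) (j : J) (s : strategy x (M j))
    (q : nat -> state N) (a : nat -> valuation) : Prop :=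
  let r := fun t => comp_state (q t) j in
  forall t, r t <> r t.+1 ->
    prescribed s r t
      (r t, ((a t + label (q t))%fset.[& invars (M j)])%fmap, r t.+1).

Definition word_implements (x : memory) (C : {set J})
    (s : forall j, strategy x (M j)) (w : nat -> valuation) : Prop :=
  exists (q : nat -> state N) (a : nat -> valuation),
    [/\ is_trace q a, w = derived q & forall j, j \in C -> implements (s j) q a].

(* s has an irrelevant value outside C. *)
Definition enforces (x : memory) (C : {set J})
    (relevant : (nat -> valuation) -> Prop) (g : ltl) : Prop :=
  (ltl_vars g `<=` stvars N)%fset
  /\ exists s : forall j, strategy x (M j),
      (forall j, j \in C -> is_strategy (R j) (s j))
      /\ forall w, word_implements C s w -> relevant w -> sat w g.

End Strategic.

Definition system_models (J : finType) (M : J -> module)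
    (asyncM : pairwise_async M) (R : forall j, repertoire (M j))
    (x : memory) (C : {set J}) (g : ltl) : Prop :=
  enforces (N := bigcomp asyncM) R
    (fun (q : bigcomp_state M) j => q j) x C (fun=> True) g.

Definition system_assumption_models (J : finType) (M : J -> module)
    (asyncM : pairwise_async M) (R : forall j, repertoire (M j))
    (A : assumption) (x : memory) (C : {set J}) (g : ltl) : Prop :=
  let MA := comp_assumption (bigcomp asyncM) A in
  enforces (N := MA) R
    (fun (q : bigcomp_state M * state A) j => q.1 j) x C (accepted MA) g.

Section Neighbourhoods.
Context (J : finType) (M : J -> module).

Definition neighbours (j : J) : {set J} :=
  [set l | (invars (M l) `&` stvars (M j) != fset0)%fset
           || (invars (M j) `&` stvars (M l) != fset0)%fset]%SET.

(* Meaningful for k >= 1 only. *)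
Fixpoint nbhd (P : {set J}) (k : nat) : {set J} :=
  match k with
  | 0 | 1 => ((\bigcup_(j in P) neighbours j) :\: P)%SET
  | k'.+1 => ((nbhd P k' :|: \bigcup_(j in nbhd P k') neighbours j) :\: P)%SET
  end.

End Neighbourhoods.

End Modules.

Arguments LTrue {V D}.
Arguments ltl : clear implicits.
Arguments module : clear implicits.
Arguments assumption : clear implicits.

(* Main.v *)
(* For P = {C} and k = n, the assumption is Comp_n^C itself, with every state
   accepting, so that Comp_n^C guarantees it without curtailment.  The set of
   agents C together with its n-th neighbourhood is closed under interaction,
   so the remaining agents can at most share external inputs with it; hence
   every trace of the composition of C with the assumption extends to a trace
   of the whole system, and the joint strategy for the whole system can be kept.
   In the extended trace the remaining agents take transitions at every step:
   if they idled, a step in which C and the assumption idle could be pruned. *)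
Require Import Defs.
From mathcomp Require Import all_boot finmap.
From mathcomp Require boolp.

Section Traces.
Set Implicit Arguments.
Unset Strict Implicit.
Unset Printing Implicit Defensive.
Context (V : choiceType) (D : Type).
Implicit Types (L M N : module V D) (a : valuation V D).
Local Open Scope fmap_scope.

(** * Inputs seen by a component of a composed module *)

(** This is the valuation at which [implements] consults a strategy of [L]: state variables of [N]
    are read from the label, which has priority in the union, the others from the external input. *)
Definition local_input L N a (q : state N) : valuation V D :=
  (a + label q)%fset.[& invars L].

Lemma fnd_local_input L N a (q : state N) y : y \in invars L ->
  (local_input L a q).[? y] = if y \in stvars N then (label q).[? y] else a.[? y].
Proof. by move=> yL; rewrite fnd_restrict yL fnd_cat in_label. Qed.

Lemma local_input_eq L N a (q : state N) (b : valuation V D) :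
  domf b = invars L ->
  (forall y, y \in invars L ->
     b.[? y] = if y \in stvars N then (label q).[? y] else a.[? y]) ->
  b = local_input L a q.
Proof.
move=> db hb; apply/fmapP => y; have [yL|yL] := boolP (y \in invars L).
  by rewrite fnd_local_input ?hb.
by rewrite fnd_restrict (negPf yL) not_fnd //; change (y \notin domf b); rewrite db.
Qed.

Lemma invars_notin_stvars M y : y \in invars M -> y \notin stvars M.
Proof.
by move=> yI; apply/negP => yX; move/fdisjointP: (vars_disj M) => /(_ y yX)/negP.
Qed.

Lemma trans_loop_unique M (p : state M) a r :
  trans (p, a, p) -> trans (p, a, r) -> r = p.
Proof.
move=> tp tr; have [//|/eqP rp] := eqVneq r p.
by case: (trans_noloop tr (nesym rp)).
Qed.

(** * Transitions of compositions in terms of local inputs *)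

Section Bigcomp.
Context (J : finType) (M : J -> module V D) (asyncM : pairwise_async M).
Implicit Types q : state (bigcomp asyncM).

Lemma fnd_bigcomp_label q (j : J) y : y \in stvars (M j) ->
  (label q).[? y] = (label ((q : bigcomp_state M) j)).[? y].
Proof.
move=> yj; rewrite (fnd_bigcat (j := j)) ?in_label // => i k.
exact: compatible_label asyncM _ _ _.
Qed.

Lemma mem_bigcomp_stvars (j : J) y : y \in stvars (M j) -> y \in bigcomp_stvars M.
Proof. by move=> yj; rewrite mem_bigcup; apply/existsP; exists j. Qed.

Lemma mem_bigcomp_invars (j : J) y : y \in invars (M j) ->
  y \notin bigcomp_stvars M -> y \in bigcomp_invars M.
Proof.
by move=> yj yX; rewrite in_fsetD yX mem_bigcup; apply/existsP; exists j.
Qed.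

(** The input valuations chosen in [bigcomp_step] are forced. An input of [j] that is a state
    variable of the family belongs to another component, whose label must be compatible with it; any
    other input of [j] is an external input, whose value is recorded in [a]. *)
Lemma bigcomp_stepP q a q' :
  bigcomp_step (q, a, q') <->
  domf a = bigcomp_invars M /\ exists r : forall j, state (M j), forall j,
    trans ((q : bigcomp_state M) j, local_input (M j) a q, r j)
    /\ ((q' : bigcomp_state M) j = (q : bigcomp_state M) j
        \/ (q' : bigcomp_state M) j = r j).
Proof.
split=> [[b [r [/= tb [cb lb] ea eq']]]|[da [r hr]]].
  have db j y : (y \in domf (b j)) = (y \in invars (M j)).
    by rewrite (trans_dom (tb j)).
  split.
    rewrite ea; apply/fsetP => y; rewrite in_domf_restrict mem_bigcat.
    apply: andb_idr; rewrite in_fsetD mem_bigcup => /andP[_ /existsP[j yj]].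
    by apply/existsP; exists j; rewrite db.
  exists r => j; split; last exact: eq'.
  rewrite -(@local_input_eq _ _ a q (b j)) ?(trans_dom (tb j)) // => y yj.
  case: ifP => [|/negbT yX].
    rewrite mem_bigcup => /existsP[i yi]; rewrite (fnd_bigcomp_label _ yi).
    rewrite -(lb i j) ?in_label ?db //.
    by move=> ij; move: (invars_notin_stvars yj); rewrite -ij yi.
  rewrite ea fnd_restrict (mem_bigcomp_invars yj yX).
  by rewrite (fnd_bigcat (j := j)) ?db.
pose b j := local_input (M j) a q.
have db j y : (y \in domf (b j)) = (y \in invars (M j)).
  by rewrite (trans_dom (hr j).1).
have cb i k : compatible (b i) (b k).
  by move=> y; rewrite !db => yi yk; rewrite !fnd_local_input.
exists b, r; split=> [j||/=|j]; [exact: (hr j).1| | |exact: (hr j).2].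
  split=> //= i j _ y; rewrite in_label db => yi yj.
  by rewrite fnd_local_input // (mem_bigcomp_stvars yi) (fnd_bigcomp_label _ yi).
apply/fmapP => y; rewrite fnd_restrict; case: ifP => yI; last first.
  by apply: not_fnd; change (y \notin domf a); rewrite da yI.
move: (yI); rewrite in_fsetD mem_bigcup => /andP[yX /existsP[j yj]].
by rewrite (fnd_bigcat (j := j)) ?db // fnd_local_input // (negPf yX).
Qed.

(** Pruning compares a self-loop with the step in which all components move, so a surviving
    self-loop consists of local loops only. Conversely, a local loop excludes every other local
    transition under the same input, so a self-loop made of local loops has no competitor. *)
Lemma bigcomp_transP q a q' :
  trans (q, a, q') <->
  [/\ domf a = bigcomp_invars M,
      forall j, (q' : bigcomp_state M) j = (q : bigcomp_state M) j
        \/ trans ((q : bigcomp_state M) j, local_input (M j) a q,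
                  (q' : bigcomp_state M) j)
    & q = q' -> forall j, trans ((q : bigcomp_state M) j, local_input (M j) a q,
                                 (q : bigcomp_state M) j)].
Proof.
split=> [[/bigcomp_stepP[da [r hr]] loop]|[da hq' loop]].
  split=> // [j|qq' j].
    by have [tr [->|->]] := hr j; [left|right].
  have step_r : bigcomp_step (q, a, [ffun j => r j]).
    apply/bigcomp_stepP; split=> //; exists r => i.
    by split; [exact: (hr i).1|right; rewrite ffunE].
  have e : [ffun j => r j] = q :> bigcomp_state M by rewrite qq'; apply: loop step_r.
  by have := (hr j).1; rewrite -[r j](ffunE (fun j => r j)) e.
(* [bigcomp_step] asks for a transition of every component, including one that keeps its state;
   seriality supplies it. *)
have hr : forall j, exists r,
    trans ((q : bigcomp_state M) j, local_input (M j) a q, r)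
    /\ ((q' : bigcomp_state M) j = (q : bigcomp_state M) j
        \/ (q' : bigcomp_state M) j = r).
  move=> j; have [e|t] := hq' j; last by exists ((q' : bigcomp_state M) j); auto.
  have [r tr] : exists r,
      trans ((q : bigcomp_state M) j, local_input (M j) a q, r).
    apply: trans_serial; apply/fsetP => y.
    rewrite in_domf_restrict; apply: andb_idr => yj.
    rewrite in_domf_cat in_label da.
    have [yX|yX] := boolP (y \in stvars (bigcomp asyncM)); first by rewrite orbT.
    by rewrite (mem_bigcomp_invars yj yX).
  by exists r; auto.
have [r {}hr] := fin_all_exists hr.
split; first by apply/bigcomp_stepP; split=> //; exists r.
move=> /= qq' p /bigcomp_stepP[_ [r' hr']]; rewrite -qq'.
apply/ffunP => j; have [t [//|->]] := hr' j.
exact: trans_loop_unique (loop qq' j) t.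
Qed.

End Bigcomp.

(** As for families, compatibility forces [a1] and [a2] to be the local inputs. The steps moving
    only one of the two modules are also available, so a self-loop survives pruning only if both
    [r1] and [r2] are the old states. *)
Lemma comp_trans_local M1 M2 (q q' : state (Defs.comp M1 M2)) a :
  trans (q, a, q') ->
  [/\ q'.1 = q.1 \/ trans (q.1, local_input M1 a q, q'.1),
      q'.2 = q.2 \/ trans (q.2, local_input M2 a q, q'.2)
    & q = q' -> trans (q.1, local_input M1 a q, q.1)
                /\ trans (q.2, local_input M2 a q, q.2)].
Proof.
move=> [[a1 [a2 [r1 [r2 [/= [t1 t2] [c12 c1 c2] ea et]]]]] loop].
have d1 y : (y \in domf a1) = (y \in invars M1) by rewrite (trans_dom t1).
have d2 y : (y \in domf a2) = (y \in invars M2) by rewrite (trans_dom t2).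
have e1 : a1 = local_input M1 a q.
  apply: local_input_eq (trans_dom t1) _ => y y1; rewrite ea in_fsetU fnd_cat fnd_restrict.
  rewrite (negPf (invars_notin_stvars y1)) in_label /=.
  have [y2|y2] := boolP (y \in stvars M2); first by rewrite c2 ?in_label ?d1.
  rewrite in_fsetD !in_fsetU y1 (negPf (invars_notin_stvars y1)) (negPf y2) /=.
  rewrite fnd_cat; case: ifP => // y2'; by apply: c12; rewrite ?d1.
have e2 : a2 = local_input M2 a q.
  apply: local_input_eq (trans_dom t2) _ => y y2; rewrite ea in_fsetU fnd_cat fnd_restrict.
  rewrite (negPf (invars_notin_stvars y2)) in_label orbF.
  rewrite (negPf (invars_notin_stvars y2)).
  have [y1|y1] := boolP (y \in stvars M1); first by rewrite c1 ?in_label ?d2.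
  rewrite in_fsetD !in_fsetU y2 (negPf (invars_notin_stvars y2)) (negPf y1) orbT /=.
  by rewrite fnd_cat d2 y2.
rewrite -e1 -e2; split.
- by case: et => ->; auto.
- by case: et => ->; auto.
move=> qq'; have /(congr1 fst)/= e : (r1, q.2) = q'.
  by apply: loop => //; exists a1, a2, r1, r2; split=> //=; apply: Or31.
have /(congr1 snd)/= e' : (q.1, r2) = q'.
  by apply: loop => //; exists a1, a2, r1, r2; split=> //=; apply: Or32.
by move: t1 t2; rewrite e e' -qq'.
Qed.

(** * Formulas, and inputs read through a subsystem *)

(** Allows the word of a subsystem to be exchanged for the word of the whole system, which has more
    variables. *)
Lemma eq_sat (w w' : nat -> valuation V D) (g : ltl V D) :
  (forall t y, y \in ltl_vars g -> (w t).[? y] = (w' t).[? y]) ->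
  sat w g <-> sat w' g.
Proof.
elim: g w w' => [p|g IH|g IHg h IHh|g IHg h IHh] w w' ww' /=.
- have -> // : (w 0).[& domf p] = (w' 0).[& domf p].
  by apply/fmapP => y; rewrite !fnd_restrict; case: ifP => // /ww'.
- by split=> nw s; apply: nw; apply/(IH _ _ ww').
- have := IHg w w'; have := IHh w w'.
  case=> [t y yh|h1 h2]; first by apply: ww'; rewrite in_fsetU yh orbT.
  case=> [t y yg|g1 g2]; first by apply: ww'; rewrite in_fsetU yg.
  by split=> -[]; auto.
have Hg i : sat (fun t => w (i + t)) g <-> sat (fun t => w' (i + t)) g.
  by apply: IHg => t y yg; apply: ww'; rewrite in_fsetU yg.
have Hh i : sat (fun t => w (i + t)) h <-> sat (fun t => w' (i + t)) h.
  by apply: IHh => t y yh; apply: ww'; rewrite in_fsetU yh orbT.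
by split=> -[j /Hh sj si]; exists j => // i /si /Hg.
Qed.

Lemma mem_ltl_vars_bigAnd (J : finType) (C : {set J}) (psi : J -> ltl V D) y :
  y \in ltl_vars (\big[And (D := D)/LTrue]_(j in C) psi j) ->
  exists2 j, j \in C & y \in ltl_vars (psi j).
Proof.
elim/big_ind: _ => [|g h IHg IHh|j jC]; first by rewrite in_fset0.
  by rewrite in_fsetU => /orP[/IHg|/IHh].
by exists j.
Qed.


(** A variable read by [L] is either a state variable of [N1], where both labels agree, or an input
    of [N1], whose value is already the one read in [N]. Thus a composition of compositions can be
    flattened to its agents. *)
Lemma local_input_nested L N1 N a (q1 : state N1) (q : state N) :
  (invars L `<=` stvars N1 `|` invars N1)%fset ->
  (stvars N1 `<=` stvars N)%fset ->
  (forall y, y \in stvars N1 -> (label q1).[? y] = (label q).[? y]) ->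
  local_input L (local_input N1 a q) q1 = local_input L a q.
Proof.
move=> /fsubsetP LN1 /fsubsetP XN1 lq; apply/fmapP => y.
rewrite [LHS]fnd_restrict [RHS]fnd_restrict; case: ifP => // /LN1.
rewrite in_fsetU !fnd_cat !in_label fnd_restrict.
case: ifP => [y1 _|_ /= ->]; first by rewrite (XN1 _ y1) lq.
by rewrite fnd_cat in_label.
Qed.

(** * Extending traces of two blocks, jointly closed under reading, to the whole system *)

Section Extension.
Context (J : finType) (M : J -> module V D) (asyncM : pairwise_async M).
Context (C K : {set J}) (CK_disj : [disjoint C & K]).
Context (CK_closed : forall j l y, j \in C :|: K ->
  y \in invars (M j) -> y \in stvars (M l) -> l \in C :|: K).

Let BC := bigcomp (subfamily_async (P := C) asyncM).
Let BK := bigcomp (subfamily_async (P := K) asyncM).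
Let N := Defs.comp BC BK.

Definition restrict_state (P : {set J}) (Q : bigcomp_state M) :
    bigcomp_state (subfamily (P := P) M) :=
  [ffun j : {j | j \in P} => Q (val j)].

Let restr (Q : bigcomp_state M) : state N :=
  (restrict_state C Q, restrict_state K Q).

Lemma mem_subfamily_stvars (P : {set J}) y :
  reflect (exists2 j, j \in P & y \in stvars (M j))
          (y \in bigcomp_stvars (subfamily (P := P) M)).
Proof.
rewrite mem_bigcup; apply: (iffP existsP) => [[[j jP] yj]|[j jP yj]].
  by exists j.
by exists (exist _ j jP).
Qed.

Lemma mem_comp_stvars y :
  reflect (exists2 j, j \in C :|: K & y \in stvars (M j)) (y \in stvars N).
Proof.
rewrite in_fsetU; apply: (iffP orP) => [[]|[j]].
- by case/mem_subfamily_stvars => j jC yj; exists j; rewrite // in_setU jC.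
- by case/mem_subfamily_stvars => j jK yj; exists j; rewrite // in_setU jK orbT.
rewrite in_setU => /orP[jC|jK] yj; [left|right];
  by apply/mem_subfamily_stvars; exists j.
Qed.

Lemma subfamily_async_stvars (P P' : {set J}) y : [disjoint P & P'] ->
  y \in bigcomp_stvars (subfamily (P := P) M) ->
  y \notin bigcomp_stvars (subfamily (P := P') M).
Proof.
move=> PP' /mem_subfamily_stvars[j jP yj]; apply/mem_subfamily_stvars => -[i iP' yi].
have [ij|/eqP ij] := eqVneq i j.
  by have := disjointFr PP' jP; rewrite -ij iP'.
by have /fdisjointP/(_ y yi)/negP := asyncM ij.
Qed.

Lemma fnd_subfamily_label (P : {set J}) (Q : bigcomp_state M) y :
  y \in bigcomp_stvars (subfamily (P := P) M) ->
  (label (restrict_state P Q : state (bigcomp (subfamily_async asyncM)))).[? y]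
    = (label (Q : state (bigcomp asyncM))).[? y].
Proof.
case/mem_subfamily_stvars => j jP yj; rewrite (fnd_bigcomp_label _ yj).
rewrite (@fnd_bigcomp_label _ _ _ _ (exist _ j jP)) //.
by rewrite ffunE.
Qed.

Lemma fnd_restr_label Q y : y \in stvars N ->
  (label (restr Q)).[? y] = (label (Q : state (bigcomp asyncM))).[? y].
Proof.
rewrite in_fsetU fnd_cat => yN; rewrite [in LHS]in_label.
have [yK|yK] := boolP (y \in stvars BK); first exact: fnd_subfamily_label.
by rewrite (negPf yK) orbF in yN; apply: fnd_subfamily_label.
Qed.

Lemma subfamily_invars_sub (P : {set J}) (i : J) : i \in P ->
  (invars (M i) `<=` stvars (bigcomp (subfamily_async (P := P) asyncM))
     `|` invars (bigcomp (subfamily_async (P := P) asyncM)))%fset.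
Proof.
move=> iP; apply/fsubsetP => y yi; rewrite in_fsetU.
have [//|yX] /= := boolP (_ \in stvars _).
exact: (@mem_bigcomp_invars _ _ (exist _ i iP)).
Qed.

Lemma mem_comp_invars (i : J) y : i \in C :|: K -> y \in invars (M i) ->
  y \notin stvars N -> y \in invars N.
Proof.
move=> iCK yi yN; rewrite in_fsetD [X in ~~ X && _](negPf yN) /=.
move: yN; rewrite !in_fsetU negb_or => /andP[yC yK].
case/setUP: iCK => [/subfamily_invars_sub|/subfamily_invars_sub] /fsubsetP/(_ y yi);
  by rewrite in_fsetU ?(negPf yC) ?(negPf yK) /= => ->; rewrite ?orbT.
Qed.

(** If an input of [N] were a state variable of the whole system, closure would place its owner in
    [C :|: K], making it a state variable of [N]. *)
Lemma comp_invars_sub : (invars N `<=` bigcomp_invars M)%fset.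
Proof.
apply/fsubsetP => y; rewrite in_fsetD => /andP[yN yI].
have [i iCK yi] : exists2 i, i \in C :|: K & y \in invars (M i).
  move: yI; rewrite in_fsetU !in_fsetD !mem_bigcup.
  case/orP=> /andP[_ /existsP[[i iP] yi]]; exists i => //; by rewrite in_setU iP ?orbT.
apply: (mem_bigcomp_invars yi); apply: contra yN; rewrite mem_bigcup => /existsP[l yl].
by apply/mem_comp_stvars; exists l => //; apply: CK_closed yi yl.
Qed.

(** On state variables of [N] the labels agree. Any other input of [i] is an input of [N], hence by
    [comp_invars_sub] external to the whole system as well, and there [u] agrees with [a]. *)
Lemma local_input_restr (i : J) Q a (u : valuation V D) : i \in C :|: K ->
  (forall y, y \in invars N -> u.[? y] = a.[? y]) ->
  local_input (M i) u (Q : state (bigcomp asyncM)) = local_input (M i) a (restr Q).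
Proof.
move=> iCK ua; apply/fmapP => y; have [yi|yi] := boolP (y \in invars (M i)); last first.
  by rewrite !fnd_restrict (negPf yi).
rewrite !fnd_local_input //.
have [yN|yN] := boolP (y \in stvars N).
  rewrite fnd_restr_label // ifT //.
  by case/mem_comp_stvars: yN => j _ /mem_bigcomp_stvars.
have yI := mem_comp_invars iCK yi yN; rewrite ifF ?ua //.
have /(fsubsetP comp_invars_sub) := yI.
by rewrite in_fsetD => /andP[/negPf].
Qed.

Lemma subfamily_trans_local (P : {set J}) Q a p (i : J) (iP : i \in P) :
  (bigcomp_stvars (subfamily (P := P) M) `<=` stvars N)%fset ->
  let B := bigcomp (subfamily_async (P := P) asyncM) in
  @trans _ _ B (restrict_state P Q, local_input B a (restr Q), p) ->
  (p (exist _ i iP) = Q i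
   \/ trans (Q i, local_input (M i) a (restr Q), p (exist _ i iP)))
  /\ (restrict_state P Q = p -> trans (Q i, local_input (M i) a (restr Q), Q i)).
Proof.
move=> PN B /bigcomp_transP[_ hp loop].
have nested : local_input (M i) (local_input B a (restr Q)) (restrict_state P Q : state B)
    = local_input (M i) a (restr Q).
  apply: local_input_nested => //; first exact: subfamily_invars_sub.
  by move=> y yP; rewrite fnd_subfamily_label // fnd_restr_label // (fsubsetP PN).
split=> [|e]; first by have := hp (exist _ i iP); rewrite ffunE nested.
by have := loop e (exist _ i iP); rewrite ffunE nested.
Qed.

(** Agents of [C] and [K] go where [q'] puts them, which is allowed since they read the same inputs
    on both sides. If the global step is a self-loop, so is the step of [N], and its local loops are
    those that [bigcomp_transP] requires. *)
Lemma restr_step Q a q' (u : valuation V D) :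
  trans (restr Q, a, q') -> domf u = bigcomp_invars M ->
  (forall y, y \in invars N -> u.[? y] = a.[? y]) ->
  exists Q', @trans _ _ (bigcomp asyncM) (Q, u, Q') /\ restr Q' = q'.
Proof.
move=> /comp_trans_local[/= t1 t2 loop] du ua.
have CN : (bigcomp_stvars (subfamily (P := C) M) `<=` stvars N)%fset.
  exact: fsubsetUl.
have KN : (bigcomp_stvars (subfamily (P := K) M) `<=` stvars N)%fset.
  exact: fsubsetUr.
pose b i := local_input (M i) u (Q : state (bigcomp asyncM)).
have eb i : i \in C :|: K -> b i = local_input (M i) a (restr Q).
  by move=> iCK; apply: local_input_restr.
(* One statement serves all agents: the last two clauses range over membership proofs and are
   vacuous outside the respective block. The second clause provides the local loops for the case of
   a global self-loop. *)
have /fin_all_exists[Q' hQ'] : forall i, exists r : state (M i),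
    [/\ r = Q i \/ trans (Q i, b i, r),
        restr Q = q' -> r = Q i -> trans (Q i, b i, Q i),
        forall iC, r = q'.1 (exist _ i iC)
      & forall iK, r = q'.2 (exist _ i iK)].
  move=> i; have /orP[iC|iC] := orbN (i \in C).
    rewrite eb ?in_setU ?iC //; exists (q'.1 (exist _ i iC)); split.
    - case: t1 => [->|/(subfamily_trans_local iC CN)[]//].
      by left; rewrite ffunE.
    - by move=> /[dup] e /loop[/(subfamily_trans_local iC CN)[_ h] _] _; apply: h.
    - by move=> iC'; rewrite (bool_irrelevance iC' iC).
    by move=> iK; have := disjointFr CK_disj iC; rewrite iK.
  have /orP[iK|iK] := orbN (i \in K).
    rewrite eb ?in_setU ?iK ?orbT //; exists (q'.2 (exist _ i iK)); split.
    - case: t2 => [->|/(subfamily_trans_local iK KN)[]//].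
      by left; rewrite ffunE.
    - by move=> /[dup] e /loop[_ /(subfamily_trans_local iK KN)[_ h]] _; apply: h.
    - by move=> iC'; rewrite iC' in iC.
    by move=> iK'; rewrite (bool_irrelevance iK' iK).
  have [r tr] : exists r, trans (Q i, b i, r).
    apply: trans_serial; apply/fsetP => y.
    rewrite in_domf_restrict; apply: andb_idr => yi.
    rewrite in_domf_cat in_label du.
    have [yX|yX] := boolP (y \in stvars (bigcomp asyncM)); first by rewrite orbT.
    by rewrite (mem_bigcomp_invars yi yX).
  exists r; split; first by right.
  - by move=> _ e; rewrite -{2}e.
  - by move=> iC'; rewrite iC' in iC.
  by move=> iK'; rewrite iK' in iK.
have rQ' : restr [ffun i => Q' i] = q'.
  case: q' {t1 t2 loop} hQ' => q1 q2 hQ'; congr pair; apply/ffunP => -[i iP];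
    by have [_ _ h1 h2] := hQ' i; rewrite !ffunE; (exact: h1 || exact: h2).
exists [ffun i => Q' i]; split=> //; apply/bigcomp_transP; split=> // [i|e i].
  by rewrite ffunE; have [] := hQ' i.
have [_ h _ _] := hQ' i; apply: h; first by rewrite e.
by rewrite [in RHS]e ffunE.
Qed.

Lemma restr_trace (d : D) (q : nat -> state N) (a : nat -> valuation V D) :
  is_trace q a ->
  exists (Q : nat -> bigcomp_state M) (u : nat -> valuation V D),
    [/\ is_trace (M := bigcomp asyncM) Q u, forall t, restr (Q t) = q t
      & forall t y, y \in invars N -> (u t).[? y] = (a t).[? y]].
Proof.
move=> [q0 tq].
(* The value [d] fills the external inputs read only by the remaining agents; [a t] overrides it on
   the inputs of [N]. *)
pose u t : valuation V D := ([fmap y : bigcomp_invars M => d] + a t)%fset.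
have du t : domf (u t) = bigcomp_invars M.
  apply/fsetP => y; rewrite in_domf_cat (trans_dom (tq t)) orb_idr //.
  exact: (fsubsetP comp_invars_sub).
have ua t y : y \in invars N -> (u t).[? y] = (a t).[? y].
  by move=> yN; rewrite fnd_cat ifT //; rewrite (trans_dom (tq t)).
(* The successor is chosen for every pair of a time and a state, with an arbitrary value when the
   state does not project to [q t], so that the trace can be defined by recursion. *)
have /boolp.choice[f hf] : forall tQ : nat * bigcomp_state M,
    exists Q', restr tQ.2 = q tQ.1 ->
      @trans _ _ (bigcomp asyncM) (tQ.2, u tQ.1, Q') /\ restr Q' = q tQ.1.+1.
  move=> [t Q] /=; have [e|/eqP ne] := eqVneq (restr Q) (q t); last by exists Q.
  have := tq t; rewrite -e => /restr_step/(_ (du t) (ua t))[Q' hQ'].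
  by exists Q'.
pose Q := nat_rect (fun=> bigcomp_state M) (bigcomp_init M) (fun t Q => f (t, Q)).
have rQ t : restr (Q t) = q t.
  elim: t => [|t /(hf (t, Q t))[]//].
  by rewrite q0; congr pair; apply/ffunP => j; rewrite !ffunE.
exists Q, u; split=> //; split=> // t.
by have [] := hf (t, Q t) (rQ t).
Qed.

(** In the extended trace each agent of [C] has the same local states and the same local inputs, so
    its strategy from the whole system is implemented there too, and the formula transfers back. *)
Lemma system_assumption_models_closed (d : D) (F : {set state BK})
    (R : forall j, repertoire (M j)) (x : memory) (g : ltl V D) :
  (forall y, y \in ltl_vars g ->
     exists2 j, j \in C & y \in (stvars (M j) `|` invars (M j))%fset) ->
  system_models asyncM R x C g ->
  system_assumption_models (subfamily_async (P := C) asyncM)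
    (fun j : {j | j \in C} => R (val j)) (Assumption F) x [set: {j | j \in C}] g.
Proof.
move=> gC [gX [s [sR sg]]].
(* A variable of [g] may be an input of an agent in [C]. The judgement for the whole system makes it
   a state variable of some agent, and closure puts that agent in [C :|: K]. *)
have gN : (ltl_vars g `<=` stvars N)%fset.
  apply/fsubsetP => y yg; have [j jC] := gC y yg.
  have jCK : j \in C :|: K by rewrite in_setU jC.
  rewrite in_fsetU => /orP[yj|yj]; first by apply/mem_comp_stvars; exists j.
  have := fsubsetP gX y yg; rewrite mem_bigcup => /existsP[l yl].
  by apply/mem_comp_stvars; exists l => //; apply: CK_closed yj yl.
split=> //; exists (fun j => s (val j)); split=> [[j jC] _|w]; first exact: sR.
move=> [q [a [tq -> imp]]] _; have [Q [u [tQ rQ ua]]] := restr_trace d tq.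
apply/(@eq_sat _ (derived (M := bigcomp asyncM) Q)).
  by move=> t y yg; rewrite /derived -rQ fnd_restr_label // (fsubsetP gN).
apply: sg => //; exists Q, u; split=> // j jC.
have er t : Q t j = (q t).1 (exist _ j jC) by rewrite -rQ ffunE.
have := imp (exist _ j jC) (in_setT _); rewrite /implements /=.
(* The local runs are identified as functions, since a strategy with perfect recall depends on the
   whole prefix. *)
rewrite -(boolp.funext er) => h t; rewrite !er => ne; move: (h t ne).
have jCK : j \in C :|: K by rewrite in_setU jC.
by have := local_input_restr (Q t) jCK (ua t); rewrite rQ /local_input /= => ->.
Qed.

End Extension.

(** * Stabilisation of the neighbourhoods *)

Section NeighbourhoodClosure.
Context (J : finType) (M : J -> module V D) (P : {set J}).

Let nb (X : {set J}) : {set J} := \bigcup_(j in X) neighbours M j.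
(** Including [nb P] makes the neighbourhoods iterates of a single monotone operator from [set0];
    from the second iteration on it adds nothing, by [nbhd_sub1]. *)
Let F (X : {set J}) : {set J} := (nb P :|: X :|: nb X) :\: P.

Lemma nbhd_disjoint k : [disjoint P & nbhd M P k].
Proof.
by rewrite disjoint_sym disjoints_subset; case: k => [|[|k]] /=;
  rewrite setDE subsetIr.
Qed.

Lemma nbhd_sub1 k : nb P :\: P \subset nbhd M P k.+1.
Proof.
elim: k => [|k IHk] //; apply: (subset_trans IHk) => /=.
apply/subsetP => j jk; rewrite in_setD in_setU jk andbT.
by have := disjointFl (nbhd_disjoint k.+1) jk => ->.
Qed.

Lemma nbhd_iter k : nbhd M P k.+1 = iter k.+1 F set0.
Proof.
elim: k => [|k IHk].
  by rewrite /= /F /nb big_set0 !setU0.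
rewrite iterS -IHk /F [LHS]/= -/(nb _).
apply/setP => j; rewrite !in_setD !in_setU.
have [//|jP] := boolP (j \in P).
have /subsetP/(_ j) := nbhd_sub1 k; rewrite in_setD jP /=.
by case: (j \in nb P) => //= ->.
Qed.

(** The iterates from [set0] of a monotone operator on subsets of [J] reach its least fixed point
    within [#|J|] rounds. Positivity matches [nbhd_iter], which starts at index one. *)
Lemma nbhd_fixed : 0 < #|J| -> F (nbhd M P #|J|) = nbhd M P #|J|.
Proof.
have monoF : {homo F : X Y / X \subset Y}.
  move=> X Y XY; apply: setSD; apply: setUSS; first exact: setUS.
  apply/bigcupsP => j jX; apply: bigcup_sup; exact: (subsetP XY).
move=> J0; have := fixsetK monoF; rewrite /fixset.
by rewrite -(prednK J0) -nbhd_iter.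
Qed.

(** The owner of an input of [j] is a neighbour of [j], so outside [P] it is added by one more
    application of [F], which changes nothing. *)
Lemma nbhd_closed j l y : j \in P :|: nbhd M P #|J| ->
  y \in invars (M j) -> y \in stvars (M l) -> l \in P :|: nbhd M P #|J|.
Proof.
move=> jPN yj yl; rewrite in_setU; have [//|lP] /= := boolP (l \in P).
have lj : l \in neighbours M j.
  rewrite inE; apply/orP; right; apply/fset0Pn; exists y.
  by rewrite in_fsetI yj.
rewrite -nbhd_fixed; last by apply/card_gt0P; exists j.
rewrite in_setD lP !in_setU; case/setUP: jPN => jX; apply/orP.
  by left; apply/orP; left; apply/bigcupP; exists j.
by right; apply/bigcupP; exists j.
Qed.

End NeighbourhoodClosure.

(** * A composition guarantees itself *)

Lemma bigcomp_guarantees (J : finType) (M : J -> module V D)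
    (asyncM : pairwise_async M) :
  guarantees asyncM (Assumption [set: state (bigcomp asyncM)]).
Proof.
split=> [||q u tq]; [exact: fsubset_refl|exact: fsubsetDl|].
(* With [c = id] every segment has length one and [(c i.+1).-1] is [i]; the input prescribed by the
   guarantee is then [u i], because inputs and state variables are disjoint. *)
exists id, (fun i => label (q i)); split=> //.
  move=> i l; rewrite -ltnS => /andP[]; rewrite ltnS ltnS => il li.
  have -> : l = i by apply/anti_leq; rewrite li.
  apply/fmapP => y; rewrite fnd_restrict; case: ifP => // /negbT yX.
  by apply: not_fnd; change (y \notin domf (label (q i))); rewrite in_label.
exists q; split=> // [|m]; last by exists m; rewrite ?in_setT.
case: tq => q0 tq; split=> // t; have := tq t; congr (trans (_, _, _)).
apply/fmapP => y; rewrite fnd_restrict fnd_cat in_label /=.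
case: ifP => [yI|/negbT yI].
  by rewrite (negPf (invars_notin_stvars (M := bigcomp asyncM) yI)).
by rewrite not_fnd //; change (y \notin domf (u t)); rewrite (trans_dom (tq t)).
Qed.

End Traces.

(** * Completeness with at most one block and the full neighbourhood *)

Theorem theorem4 (V : choiceType) (D : Type) (D_inhabited : inhabited D)
    (n : nat) (n_gt0 : 0 < n) (M : 'I_n -> module V D)
    (asyncM : pairwise_async M) (R : forall j, repertoire (M j))
    (C : {set 'I_n}) :
  exists (P : {set {set 'I_n}}) (k : nat),
    [/\ partition P C, 1 <= k <= n
      & forall (x : memory) (psi : 'I_n -> ltl V D),
        (forall j, j \in C -> local (M j) (psi j)) ->
        system_models asyncM R x C (\big[And (D := D)/LTrue]_(j in C) psi j) ->
        exists A : {set 'I_n} -> assumption V D,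
          forall Pi, Pi \in P ->
            [/\ asynchronous (bigcomp (subfamily_async (P := Pi) asyncM)) (A Pi),
                system_assumption_models (subfamily_async (P := Pi) asyncM)
                  (fun j : {j | j \in Pi} => R (val j)) (A Pi) x [set: {j | j \in Pi}]
                  (\big[And (D := D)/LTrue]_(j in Pi) psi j)
              & guarantees (subfamily_async (P := nbhd M Pi k) asyncM) (A Pi)]].
Proof.
case: D_inhabited => d.
(* A partition has no empty block, so for empty [C] the partition itself must be empty. *)
exists ([set C] :\ set0), n; split; [|by rewrite n_gt0 leqnn|].
  apply/and3P; split; last by rewrite in_setD1 eqxx.
    rewrite /cover; apply/eqP/setP => j; apply/bigcupP/idP => [[X]|jC].
      by rewrite in_setD1 in_set1 => /andP[_ /eqP ->].
    exists C; rewrite // in_setD1 in_set1 eqxx andbT.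
    by apply/set0Pn; exists j.
  apply/trivIsetP => X Y; rewrite !in_setD1 !in_set1.
  by move=> /andP[_ /eqP ->] /andP[_ /eqP ->]; rewrite eqxx.
move=> x psi psi_local sysC.
exists (fun X => Assumption
  [set: state (bigcomp (subfamily_async (P := nbhd M X n) asyncM))]) => Pi.
rewrite in_setD1 in_set1 => /andP[_ /eqP ->].
have disjC := nbhd_disjoint M C n.
split; last exact: bigcomp_guarantees.
  apply/fdisjointP => y; exact: subfamily_async_stvars.
apply: system_assumption_models_closed => // [|y /mem_ltl_vars_bigAnd[j jC yj]].
  by have := nbhd_closed (M := M) (P := C); rewrite card_ord.
by exists j => //; apply: (fsubsetP (psi_local j jC)).
Qed.
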